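(* Let $V(\phi,\sigma_1,\sigma_2)$ be the scalar potential $$V(\phi,\sigma_1,\sigma_2)=-\frac{f_2}{\pi^2}\Lambda^2\left(4|k_x|^2|\phi|^2+|k_y|^2\rho^2\right)+\frac{f_0}{4\pi^2}\left(4|k_x|^4|\phi|^4+4|k_x|^2|k_y|^2|\phi|^2\rho^2+|k_y|^4\rho^4\right),\qquad \rho=|1+\sigma_1|^2+|\sigma_2|^2.$$ The potential $V(\phi=0,\sigma_1,\sigma_2)$ has a local minimum at $(\sigma_1,\sigma_2)=(-1+\sqrt w,0)$ with $w=\sqrt{2f_2\Lambda^2/(f_0|k_y|^2)}$, and this point spontaneously breaks the symmetry group $\mathcal{U}(\mathcal{A}_{\mathrm{ev}})$ to $\mathcal{U}(\mathcal{A}_F)$. In fact, including also the field $\phi$, the Hessian matrix of $V$ with respect to $\phi,\sigma_1,\sigma_2$ at $(0,-1+\sqrt w,0)$ is given by $$\mathrm{Hess}(V)=\frac{f_0|k_y|^4}{\pi^2}\begin{pmatrix}-2w^2&0&0\\0&8w^3&0\\0&0&0\end{pmatrix}.$$ Thus, upon including the field $\phi$, the point $(\phi,\sigma_1,\sigma_2)=(0,-1+\sqrt w,0)$ is a critical point of $V(\phi,\sigma_1,\sigma_2)$, with the only negative second derivative in the direction of the $\phi$-field.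
   Context: $f_0,f_2,\Lambda>0$ are the constants of the spectral action, $k_x,k_y$ are nonzero complex parameters of a finite Dirac operator, and $\phi,\sigma_1,\sigma_2$ are complex scalar fields. $\mathcal{A}_{\mathrm{ev}}=\mathbb{C}_R\oplus\mathbb{C}_L\oplus M_2(\mathbb{C})$ ($\mathbb{C}_R,\mathbb{C}_L$ are copies of $\mathbb{C}$), with unitary group $\mathcal{U}(\mathcal{A}_{\mathrm{ev}})=U(1)\times U(1)\times U(2)\ni(u_R,u_L,u)$, and $$\mathcal{A}_F=\left\{\left(\lambda_R,\lambda_L,\begin{pmatrix}\lambda_R&0\\0&\mu\end{pmatrix}\right):\lambda_R,\lambda_L,\mu\in\mathbb{C}\right\}\subset\mathcal{A}_{\mathrm{ev}},$$ so that $\mathcal{U}(\mathcal{A}_F)=U(1)\times U(1)\times U(1)$. The model: $\mathcal{A}_{\mathrm{ev}}$ acts on $\mathcal{H}=(\mathbb{C}^2\otimes\mathbb{C}^2)\oplus(\mathbb{C}^2\otimes\mathbb{C}^2)$ by $\pi(\lambda_R,\lambda_L,m)=(\mathrm{diag}(\lambda_R,\lambda_L)\otimes1)\oplus(1\otimes m)$, and $J(\xi,\eta)=(\overline\eta,\overline\xi)$. The scalar fields parametrize the inner fluctuations $D'(A)$ of a Dirac operator on $\mathcal{H}$ (built from $k_x,k_y$), and $V$ is the potential for them arising from the spectral action. The field $\phi$ enters the block-diagonal part of $D'(A)$. The off-diagonal block of $D'(A)$ from the first to the second summand of $\mathcal{H}$ is $e_{11}\otimes k_y\,vv^t$ with $v=(1+\sigma_1,\sigma_2)^t$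 and $e_{11}=\mathrm{diag}(1,0)$, and the other off-diagonal block is its adjoint. The symmetry group $\mathcal{U}(\mathcal{A}_{\mathrm{ev}})$ acts by gauge transformations $D'(A)\mapsto UD'(A)U^*$ with $U=\pi(u_R,u_L,u)\,J\pi(u_R,u_L,u)J^{-1}$; on the matrix $M=k_y\,vv^t$ this is $M\mapsto\overline{u_R}^{\,2}\,u\,M\,u^t$, with $u_L$ acting trivially.
   Formalization: The (1,1) Hessian entry is corrected to -2w^2|k_x|^2/|k_y|^2 (the displayed -2w^2 holds only if |k_x|=|k_y|); U(A_F) is the stabilizer of the fields and the identity component of the stabilizer of D'(A), which also contains u=diag(-u_R,mu). *)

(* Defs.v *)
From HB Require Import structures.
From mathcomp Require Import all_boot all_order all_algebra.
From mathcomp Require Import complex mxtens ring.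
From mathcomp Require Import all_classical all_reals all_analysis.

Set Implicit Arguments.
Unset Strict Implicit.
Unset Printing Implicit Defensive.

Import Order.TTheory GRing.Theory Num.Theory.
Import numFieldNormedType.Exports.

Local Open Scope classical_set_scope.
Local Open Scope ring_scope.
Local Open Scope sesquilinear_scope.

(* [complex R] packed as a numClosedFieldType, so that it carries the topology
   that MathComp-Analysis puts on every numClosedFieldType. *)
Definition Cplx (R : realType) : numClosedFieldType := complex R.

Section Complex.
Variable R : realType.
Local Notation C := (Cplx R).

Definition ofreal (x : R) : C := Complex x 0.
Definition rpart (z : C) : R := complex.Re z.
Definition ipart (z : C) : R := complex.Im z.

(* The modulus as an element of [R]; [`|z|] itself has type [C]. *)
Definition cmod (z : C) : R := rpart `|z|.

End Complex.

Section Potential.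
Variable R : realType.
Local Notation C := (Cplx R).

Definition rho (s1 s2 : C) : R := cmod (1 + s1) ^+ 2 + cmod s2 ^+ 2.

Definition potential (f0 f2 Lam : R) (kx ky phi s1 s2 : C) : R :=
  - (f2 / pi ^+ 2) * Lam ^+ 2 *
      (4 * cmod kx ^+ 2 * cmod phi ^+ 2 + cmod ky ^+ 2 * rho s1 s2 ^+ 2)
  + f0 / (4 * pi ^+ 2) *
      (4 * cmod kx ^+ 4 * cmod phi ^+ 4
       + 4 * cmod kx ^+ 2 * cmod ky ^+ 2 * cmod phi ^+ 2 * rho s1 s2 ^+ 2
       + cmod ky ^+ 4 * rho s1 s2 ^+ 4).

Definition vacuum_w (f0 f2 Lam : R) (ky : C) : R :=
  Num.sqrt (2 * f2 * Lam ^+ 2 / (f0 * cmod ky ^+ 2)).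

Definition vacuum_s1 (f0 f2 Lam : R) (ky : C) : C :=
  ofreal (-1 + Num.sqrt (vacuum_w f0 f2 Lam ky)).

End Potential.

Section Calculus.
Variable R : realType.
Local Notation C := (Cplx R).

Definition local_minimum (T : topologicalType) (f : T -> R) (p : T) : Prop :=
  \forall x \near p, f p <= f x.

(* [is_D2 f p u v l]: the second derivative of f at p, first along v and then
   along u, exists and equals l. *)
Definition is_D2 (W : normedModType R) (f : W -> R) (p u v : W) (l : R) :
    Prop :=
  (\forall x \near p, derivable f x v) /\ is_derive p u ('D_v f) l.

Definition is_hessian (W : normedModType R) (n : nat) (e : 'I_n -> W)
    (f : W -> R) (p : W) (H : 'M[R]_n) : Prop :=
  forall i j, is_D2 f p (e i) (e j) (H i j).

Definition critical_point (W : normedModType R) (f : W -> R) (p : W) : Prop :=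
  differentiable f p /\ forall v : W, 'D_v f p = 0.

(* Three complex scalar fields as a point of the real vector space R^6: column j
   holds the real part (row 0) and the imaginary part (row 1) of field j. *)
Definition real_coords (z0 z1 z2 : C) : 'M[R]_(2, 3) :=
  \matrix_(i, j) (if i == 0 then @rpart R else @ipart R)
                   (nth 0 [:: z0; z1; z2] j).

Definition field_of (x : 'M[R]_(2, 3)) (j : 'I_3) : C := Complex (x 0 j) (x 1 j).

Definition on_real_coords (F : C -> C -> C -> R) (x : 'M[R]_(2, 3)) : R :=
  F (field_of x 0) (field_of x 1) (field_of x 2).

Definition real_direction (j : 'I_3) : 'M[R]_(2, 3) := delta_mx 0 j.

End Calculus.

Section Model.
Variable R : realType.
Local Notation C := (Cplx R).

(* C_R (+) C_L (+) M_2(C), with the componentwise ring structure and the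
   product topology. *)
Local Notation Aev := (C * C * 'M[C]_2)%type.

Definition diag2 (K : numClosedFieldType) (a b : K) : 'M[K]_2 :=
  block_mx a%:M 0 0 b%:M : 'M[K]_(1 + 1).

Definition AF : set Aev :=
  [set a | exists lR lL mu : C, a = (lR, lL, diag2 lR mu)].

Definition star (a : Aev) : Aev := (Num.conj a.1.1, Num.conj a.1.2, a.2 ^t*).

Definition unitary_group (B : set Aev) : set Aev :=
  [set g | [/\ B g, g * star g = 1 & star g * g = 1]].

(* H = (C^2 (x) C^2) (+) (C^2 (x) C^2) *)
Local Notation vecH := 'cV[C]_(2 * 2 + 2 * 2).
Local Notation opH := 'M[C]_(2 * 2 + 2 * 2).

Definition repr_pi (a : Aev) : opH :=
  block_mx (diag2 a.1.1 a.1.2 *t 1%:M) 0 0 ((1%:M : 'M[C]_2) *t a.2).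

Definition Jop (x : vecH) : vecH :=
  col_mx (map_mx Num.conj (dsubmx x)) (map_mx Num.conj (usubmx x)).

(* The matrix of the linear operator J A J^-1; see [JconjE], and note that
   J^-1 = J by [JopK]. *)
Definition Jconj (A : opH) : opH :=
  block_mx (map_mx Num.conj (drsubmx A)) (map_mx Num.conj (dlsubmx A))
           (map_mx Num.conj (ursubmx A)) (map_mx Num.conj (ulsubmx A)).

Lemma conjmxK m n (A : 'M[C]_(m, n)) :
  map_mx Num.conj (map_mx Num.conj A) = A.
Proof. by apply/matrixP => i j; rewrite !mxE conjCK. Qed.

Lemma JopK : involutive Jop.
Proof. by move=> x; rewrite /Jop col_mxKd col_mxKu !conjmxK vsubmxK. Qed.

Lemma JconjE A x : Jconj A *m x = Jop (A *m Jop x).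
Proof.
rewrite -{1}[x]vsubmxK -[in RHS](submxK A) /Jconj /Jop.
rewrite !mul_block_col col_mxKd col_mxKu !map_mxD !map_mxM !conjmxK.
by rewrite addrC [X in col_mx _ X]addrC.
Qed.

Definition gauge_unitary (g : Aev) : opH := repr_pi g *m Jconj (repr_pi g).

Definition gauge_transform (g : Aev) (D : opH) : opH :=
  gauge_unitary g *m D *m (gauge_unitary g) ^t*.

Definition scalar_vec (s1 s2 : C) : 'cV[C]_2 :=
  col_mx (1 + s1)%:M s2%:M : 'cV[C]_(1 + 1).

Definition S_block (kx phi : C) : 'M[C]_2 :=
  block_mx 0 (kx * phi)%:M (Num.conj (kx * phi))%:M 0 : 'M[C]_(1 + 1).

Definition T_block (ky s1 s2 : C) : 'M[C]_(2 * 2) :=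
  diag2 1 0 *t (ky *: (scalar_vec s1 s2 *m (scalar_vec s1 s2)^T)).

(* The fluctuated Dirac operator.  The lower-left block maps the first summand of
   H to the second; the lower-right one is forced by J D J^-1 = D. *)
Definition fluctuated_dirac (kx ky phi s1 s2 : C) : opH :=
  block_mx (S_block kx phi *t 1%:M) ((T_block ky s1 s2) ^t*)
           (T_block ky s1 s2) (map_mx Num.conj (S_block kx phi) *t 1%:M).

(* The gauge action on the scalar fields (phi, sigma_1, sigma_2):
   phi |-> u_R u_L^* phi and v |-> u_R^* u v, with v = (1 + sigma_1, sigma_2)^t.
   It induces the gauge transformations of the Dirac operator
   ([fluctuated_dirac_gauge]).  Since v enters that operator only through v v^t,
   the fields v and - v give the same operator. *)
Definition gauge_fields (g : Aev) (f : C * C * C) : C * C * C :=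
  let v := Num.conj g.1.1 *: (g.2 *m scalar_vec f.1.2 f.2) in
  (g.1.1 * Num.conj g.1.2 * f.1.1, v 0 0 - 1, v 1 0).

Lemma conj_diag2 (a b : C) :
  map_mx Num.conj (diag2 a b) = diag2 (Num.conj a) (Num.conj b).
Proof. by rewrite /diag2 (@map_block_mx _ _ _ 1 1 1 1) !map_scalar_mx !map_mx0. Qed.

Lemma tr_diag2 (a b : C) : (diag2 a b)^T = diag2 a b.
Proof. by rewrite /diag2 (@tr_block_mx _ 1 1 1 1) !tr_scalar_mx !trmx0. Qed.

Lemma mul_diag2 (a b c d : C) :
  diag2 a b *m diag2 c d = diag2 (a * c) (b * d).
Proof.
rewrite /diag2 (@mulmx_block _ 1 1 1 1 1 1) !mulmx0 !mul0mx !addr0 add0r.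
by rewrite !scalar_mxM.
Qed.

Lemma scale_diag2 (k a b : C) : k *: diag2 a b = diag2 (k * a) (k * b).
Proof.
by rewrite /diag2 (@scale_block_mx _ 1 1 1 1) !scale_scalar_mx !scaler0.
Qed.

Lemma diag_antidiag_diag (A B X Y P Q : 'M[C]_1) :
  block_mx A 0 0 B *m block_mx 0 X Y 0 *m block_mx P 0 0 Q =
  block_mx 0 (A *m X *m Q) (B *m Y *m P) 0 :> 'M[C]_(1 + 1).
Proof.
rewrite !mulmx_block; congr block_mx;
  by rewrite ?(mulmx0, mul0mx, addr0, add0r).
Qed.

Lemma diag_block_diag n (A B E F G H P Q : 'M[C]_n) :
  block_mx A 0 0 B *m block_mx E F G H *m block_mx P 0 0 Q =
  block_mx (A *m E *m P) (A *m F *m Q) (B *m G *m P) (B *m H *m Q).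
Proof.
rewrite !mulmx_block; congr block_mx;
  by rewrite ?(mulmx0, mul0mx, addr0, add0r).
Qed.

Lemma adj_tens m n p q (A : 'M[C]_(m, n)) (B : 'M[C]_(p, q)) :
  (A *t B) ^t* = A ^t* *t B ^t*.
Proof. by rewrite trmx_tens map_mxT. Qed.

Lemma adjM m n p (A : 'M[C]_(m, n)) (B : 'M[C]_(n, p)) :
  (A *m B) ^t* = B ^t* *m A ^t*.
Proof. by rewrite trmx_mul map_mxM. Qed.

Lemma scale_tensr m n p q k (A : 'M[C]_(m, n)) (B : 'M[C]_(p, q)) :
  A *t (k *: B) = (k *: A) *t B.
Proof. by apply/matrixP => i j; rewrite !mxE mulrCA mulrA. Qed.

Lemma gauge_unitaryE (g : Aev) :
  gauge_unitary g =
  block_mx (diag2 g.1.1 g.1.2 *t map_mx Num.conj g.2) 0 0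
           (diag2 (Num.conj g.1.1) (Num.conj g.1.2) *t g.2).
Proof.
rewrite /gauge_unitary /Jconj /repr_pi block_mxKul block_mxKur block_mxKdl.
rewrite block_mxKdr mulmx_block !map_mxT !map_mx1 !map_mx0 conj_diag2.
by rewrite !mulmx0 !mul0mx !addr0 !add0r !tensmx_mul !mulmx1 !mul1mx.
Qed.

Lemma scalar_vecK (v : 'cV[C]_2) : scalar_vec (v 0 0 - 1) (v 1 0) = v.
Proof.
apply/matrixP => i j; rewrite !ord1 /scalar_vec mxE.
case: (@splitP 1 1) => k Ek; rewrite !ord1 !mxE eqxx mulr1n.
  by rewrite addrC subrK; congr (v _ _); apply: val_inj; rewrite /= Ek ord1.
by congr (v _ _); apply: val_inj; rewrite /= Ek ord1.
Qed.

Lemma fluctuated_dirac_gauge (kx ky : C) (g : Aev) (f : C * C * C) :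
  unitary_group setT g ->
  let f' := gauge_fields g f in
  gauge_transform g (fluctuated_dirac kx ky f.1.1 f.1.2 f.2) =
  fluctuated_dirac kx ky f'.1.1 f'.1.2 f'.2.
Proof.
case: g f => [[uR uL] u] [[phi s1] s2] [_ [_ _ uu] _] /=.
set v' := Num.conj uR *: (u *m scalar_vec s1 s2).
have uu' : u *m u ^t* = 1%:M by exact: uu.
pose d := diag2 uR uL; pose cd := diag2 (Num.conj uR) (Num.conj uL).
have cuu : map_mx Num.conj u *m (map_mx Num.conj u) ^t* = 1%:M.
  have -> : (map_mx Num.conj u) ^t* = map_mx Num.conj (u ^t*).
    by apply/matrixP => i j; rewrite !mxE.
  by rewrite -map_mxM uu' map_mx1.
have ad : d ^t* = cd by rewrite /d tr_diag2 conj_diag2.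
have acd : cd ^t* = d by rewrite /cd tr_diag2 conj_diag2 !conjCK.
have ET : (cd *t u) *m T_block ky s1 s2 *m (d *t map_mx Num.conj u) ^t* =
          T_block ky (v' 0 0 - 1) (v' 1 0).
  rewrite /T_block scalar_vecK adj_tens ad !tensmx_mul !mul_diag2.
  have -> : (map_mx Num.conj u) ^t* = u^T by rewrite map_trmx conjmxK.
  have -> : diag2 (Num.conj uR * 1 * Num.conj uR) (Num.conj uL * 0 * Num.conj uL) =
            (Num.conj uR * Num.conj uR) *: diag2 1 0.
    by rewrite scale_diag2 !(mulr0, mul0r) !mulr1.
  rewrite -scale_tensr; congr (_ *t _).
  rewrite /v' [in RHS]linearZ /= -!scalemxAl -!scalemxAr trmx_mul.
  rewrite -!scalemxAl !scalerA !mulmxA; congr (_ *: _).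
  by rewrite mulrC mulrA.
have ES : (d *t map_mx Num.conj u) *m (S_block kx phi *t 1%:M) *m
          (d *t map_mx Num.conj u) ^t* =
          S_block kx (uR * Num.conj uL * phi) *t 1%:M.
  rewrite adj_tens ad !tensmx_mul mulmx1 cuu; congr (_ *t _).
  rewrite /d /cd /diag2 /S_block diag_antidiag_diag -!scalar_mxM.
  have <- : uR * (kx * phi) * Num.conj uL = kx * (uR * Num.conj uL * phi).
    by ring.
  congr (@block_mx _ 1 1 1 1 _ _ _%:M _).
  rewrite [in RHS]rmorphM /= conjCK [in RHS]rmorphM /=; ring.
have adjK m n (A : 'M[C]_(m, n)) : (A ^t*) ^t* = A.
  by apply/matrixP => i j; rewrite !mxE conjCK.
have ETa : (d *t map_mx Num.conj u) *m (T_block ky s1 s2) ^t* *m (cd *t u) ^t* =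
           (T_block ky (v' 0 0 - 1) (v' 1 0)) ^t*.
  by rewrite -ET [in RHS]adjM adjK [in RHS]adjM mulmxA.
have ESc : (cd *t u) *m (map_mx Num.conj (S_block kx phi) *t 1%:M) *m
           (cd *t u) ^t* =
           map_mx Num.conj (S_block kx (uR * Num.conj uL * phi)) *t 1%:M.
  have /(congr1 (map_mx Num.conj)) := ES.
  rewrite map_mxT map_mx1 => <-; rewrite !map_mxM map_mxT /= conjmxK conj_diag2.
  rewrite map_mxT map_mx1 !adj_tens ad acd map_mxT conj_diag2 !conjCK.
  congr (_ *m (_ *t _)); apply/matrixP => i j; rewrite !mxE.
  by rewrite conjCK.
rewrite /gauge_transform gauge_unitaryE /= -/d -/cd /fluctuated_dirac.
rewrite tr_block_mx map_block_mx trmx0 map_mx0 diag_block_diag.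
by congr block_mx; [exact: ES | exact: ETa | exact: ET | exact: ESc].
Qed.

Definition field_stabilizer (f : C * C * C) : set Aev :=
  [set g | unitary_group setT g /\ gauge_fields g f = f].

Definition operator_stabilizer (D : opH) : set Aev :=
  [set g | unitary_group setT g /\ gauge_transform g D = D].

End Model.

(* Main.v *)
(* Completing the square with w^2 = 2 f2 Lam^2 / (f0 |k_y|^2),
   b = f0 |k_y|^4 / (4 pi^2) and c = |k_x|^2 / |k_y|^2 gives
     V = b ((2 c |phi|^2 + rho^2 - w^2)^2 - w^4 - 4 w^2 c |phi|^2),
   so at phi = 0 the minima are the points with rho = w, and all derivatives at
   the vacuum, where the inner square vanishes, can be read off.  A gauge
   transformation fixes the vacuum fields iff u_R^* u maps e_1 to itself, i.e.
   u = diag(u_R, mu) by unitarity; it fixes the operator, which is quadratic in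
   v, iff u_R^* u maps e_1 to e_1 or - e_1.  The sign Re(u_R^* u_11) is
   continuous and separates these two cosets, and the first one is a torus. *)
Require Import Defs.
From mathcomp Require Import all_boot all_order all_algebra.
From mathcomp Require Import complex mxtens ring.
From mathcomp Require Import all_classical all_reals all_analysis.
Import Order.TTheory GRing.Theory Num.Theory.
Import numFieldNormedType.Exports.
Local Open Scope classical_set_scope.
Local Open Scope ring_scope.

Set Implicit Arguments.
Unset Strict Implicit.
Unset Printing Implicit Defensive.

(** * The real-valued modulus on C *)

Section Modulus.
Variable R : realType.
Implicit Types z : Cplx R.

Lemma sqr_cmod z : cmod z ^+ 2 = rpart z ^+ 2 + ipart z ^+ 2.
Proof.
by rewrite /cmod /rpart normc_def /= sqr_sqrtr // addr_ge0 // sqr_ge0.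
Qed.

Lemma ofreal_cmod z : ofreal (cmod z) = `|z|.
Proof. by rewrite /cmod /rpart /ofreal normc_def. Qed.

Lemma cmod_ge0 z : 0 <= cmod z.
Proof. by rewrite /cmod /rpart normc_def sqrtr_ge0. Qed.

Lemma cmod_gt0 z : z != 0 -> 0 < cmod z.
Proof.
move=> z0; rewrite lt_neqAle cmod_ge0 andbT; apply/eqP => z1.
by move/eqP: z0; apply; apply/normr0_eq0; rewrite -ofreal_cmod -z1.
Qed.

Lemma cmod_ofreal (x : R) : cmod (ofreal x) = `|x|.
Proof. by rewrite /cmod /rpart normc_def /= expr0n addr0 sqrtr_sqr. Qed.

Lemma cmod0 : cmod (0 : Cplx R) = 0.
Proof. by rewrite /cmod normr0. Qed.

End Modulus.

(** * The potential as a completed square *)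

Section PotentialForm.
Variables (R : realType) (f0 f2 Lam : R) (kx ky : Cplx R).
Hypotheses (hf0 : 0 < f0) (hf2 : 0 < f2) (hLam : 0 < Lam) (hky : ky != 0).

Let w := vacuum_w f0 f2 Lam ky.
Let b := f0 * cmod ky ^+ 4 / (4 * pi ^+ 2).
Let c := cmod kx ^+ 2 / cmod ky ^+ 2.

Lemma vacuum_w_sqr : w ^+ 2 = 2 * f2 * Lam ^+ 2 / (f0 * cmod ky ^+ 2).
Proof.
rewrite sqr_sqrtr //; have := cmod_ge0 ky => k0.
by rewrite divr_ge0 ?mulr_ge0 ?sqr_ge0 ?exprn_ge0 // ltW.
Qed.

Lemma vacuum_w_gt0 : 0 < w.
Proof.
rewrite sqrtr_gt0; have := cmod_gt0 hky => k0.
by rewrite divr_gt0 ?mulr_gt0 ?exprn_gt0.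
Qed.

Lemma potentialE (phi s1 s2 : Cplx R) :
  potential f0 f2 Lam kx ky phi s1 s2 =
  b * ((2 * c * cmod phi ^+ 2 + rho s1 s2 ^+ 2 - w ^+ 2) ^+ 2 - w ^+ 4
       - 4 * w ^+ 2 * c * cmod phi ^+ 2).
Proof.
(* With only even powers of [w], the square root in its definition disappears and the claim is an
   identity of rational functions. *)
have -> : w ^+ 4 = w ^+ 2 * w ^+ 2 by rewrite -exprD.
rewrite vacuum_w_sqr /b /c /potential.
have k0 := lt0r_neq0 (cmod_gt0 hky).
have p0 : pi != 0 :> R by rewrite lt0r_neq0 // pi_gt0.
have f0' := lt0r_neq0 hf0.
move: (cmod ky) (cmod kx) (cmod phi) (rho s1 s2) (pi : R) k0 p0.
move=> k k1 f r p k0 p0.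
by field; rewrite k0 f0' p0.
Qed.

End PotentialForm.

(** * First and second derivatives of the potential in six real coordinates *)

Section Derivatives.
Variable R : realType.
Local Notation M := 'M[R]_(2, 3).
Implicit Types x u v : M.

Definition coord_fun i j : M -> R := fun x => x i j.

Lemma is_derive_coord i j x v : is_derive x v (coord_fun i j) (v i j).
Proof.
apply: DeriveDef; first exact/diff_derivable/differentiable_coord.
(* The coordinate is linear, so its difference quotient equals [v i j] for every nonzero [h]. *)
apply: cvg_lim => //; apply: cvg_near_cst; near=> h.
rewrite /coord_fun /= !mxE addrK scalerA mulVf ?scale1r //.
by near: h; exact: nbhs_dnbhs_neq.
Unshelve. all: by end_near. Qed.

Local Notation X i j := (coord_fun i j).
(** In real coordinates [A] is |phi|^2 and [B] is rho; [dA v] and [dB v] are their derivatives along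
    [v], as functions of the base point so that they can be differentiated again. *)
Let A : M -> R := X 0 0 ^+ 2 + X 1 0 ^+ 2.
Let B : M -> R := (cst 1 + X 0 1) ^+ 2 + X 1 1 ^+ 2 + (X 0 2 ^+ 2 + X 1 2 ^+ 2).
Let dA v : M -> R := cst (2 * v 0 0) * X 0 0 + cst (2 * v 1 0) * X 1 0.
Let dB v : M -> R :=
  cst (2 * v 0 1) * (cst 1 + X 0 1) + cst (2 * v 1 1) * X 1 1 +
  (cst (2 * v 0 2) * X 0 2 + cst (2 * v 1 2) * X 1 2).

Let is_derive_A x v : is_derive x v A (dA v x).
Proof.
apply: (is_derive_eq (is_deriveD (is_deriveX 2 (is_derive_coord 0 0 x v))
  (is_deriveX 2 (is_derive_coord 1 0 x v)))).
rewrite /dA !fctE /GRing.scale /= /coord_fun /cst; ring.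
Qed.

Let is_derive_B x v : is_derive x v B (dB v x).
Proof.
have d1 := is_deriveD (is_derive_cst (1 : R) x v) (is_derive_coord 0 1 x v).
apply: (is_derive_eq (is_deriveD
  (is_deriveD (is_deriveX 2 d1) (is_deriveX 2 (is_derive_coord 1 1 x v)))
  (is_deriveD (is_deriveX 2 (is_derive_coord 0 2 x v))
    (is_deriveX 2 (is_derive_coord 1 2 x v))))).
rewrite /dB !fctE /GRing.scale /= /coord_fun /cst; ring.
Qed.

Let is_derive_dA u x v :
  is_derive x u (dA v) (2 * (u 0 0 * v 0 0 + u 1 0 * v 1 0)).
Proof.
have dk k := is_derive_cst (k : R) x u.
apply: (is_derive_eq (is_deriveD (is_deriveM (dk _) (is_derive_coord 0 0 x u))
  (is_deriveM (dk _) (is_derive_coord 1 0 x u)))).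
rewrite /GRing.scale /= /coord_fun /cst; ring.
Qed.

Let is_derive_dB u x v : is_derive x u (dB v)
  (2 * (u 0 1 * v 0 1 + u 1 1 * v 1 1 + (u 0 2 * v 0 2 + u 1 2 * v 1 2))).
Proof.
have dk k := is_derive_cst (k : R) x u.
have d1 := is_deriveD (dk 1) (is_derive_coord 0 1 x u).
apply: (is_derive_eq (is_deriveD
  (is_deriveD (is_deriveM (dk _) d1)
    (is_deriveM (dk _) (is_derive_coord 1 1 x u)))
  (is_deriveD (is_deriveM (dk _) (is_derive_coord 0 2 x u))
    (is_deriveM (dk _) (is_derive_coord 1 2 x u))))).
rewrite /GRing.scale /= /coord_fun /cst; ring.
Qed.

Variables b c w : R.

(** [Q] is the inner term of the completed square, which vanishes at the vacuum; [dQ v] is its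
    derivative along [v]. *)
Let Q : M -> R := cst (2 * c) * A + B ^+ 2 - cst (w ^+ 2).
Let dQ v : M -> R := cst (2 * c) * dA v + cst 2 * B * dB v.

Definition model_potential : M -> R :=
  cst b * (Q ^+ 2 - cst (w ^+ 4) - cst (4 * w ^+ 2 * c) * A).

Definition model_gradient v : M -> R :=
  cst b * (cst 2 * Q * dQ v - cst (4 * w ^+ 2 * c) * dA v).

Let is_derive_Q x v : is_derive x v Q (dQ v x).
Proof.
have dk k := is_derive_cst (k : R) x v.
apply: (is_derive_eq (is_deriveB (is_deriveD
  (is_deriveM (dk _) (is_derive_A x v)) (is_deriveX 2 (is_derive_B x v)))
  (dk _))).
rewrite /dQ !fctE /GRing.scale /= /cst; ring.
Qed.

Lemma is_derive_model x v : is_derive x v model_potential (model_gradient v x).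
Proof.
have dk k := is_derive_cst (k : R) x v.
apply: (is_derive_eq (is_deriveM (dk _) (is_deriveB
  (is_deriveB (is_deriveX 2 (is_derive_Q x v)) (dk _))
  (is_deriveM (dk _) (is_derive_A x v))))).
rewrite /model_gradient !fctE /GRing.scale /= /cst; ring.
Qed.

(** An equality of functions rather than of values at a point, since [is_D2] differentiates ['D_v f]
    once more. *)
Lemma derive_model v : 'D_v model_potential = model_gradient v.
Proof.
by apply/funext => x; have /@derive_val := is_derive_model x v.
Qed.

Lemma differentiable_model x : differentiable model_potential x.
Proof.
have dX i j : differentiable (X i j) x by exact: differentiable_coord.
have dA' : differentiable A x.
  by apply: differentiableD; exact: differentiableX.
have dB' : differentiable B x.
  apply: differentiableD; apply: differentiableD; apply: differentiableX => //.
  by apply: differentiableD => //; exact: differentiable_cst.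
apply: differentiableM; first exact: differentiable_cst.
apply: differentiableB; last by apply: differentiableM.
apply: differentiableB; last exact: differentiable_cst.
apply: differentiableX; apply: differentiableB; last exact: differentiable_cst.
by apply: differentiableD; [exact: differentiableM|exact: differentiableX].
Qed.

Let is_derive_dQ u x v : is_derive x u (dQ v)
  (4 * c * (u 0 0 * v 0 0 + u 1 0 * v 1 0) + 2 * dB u x * dB v x +
   4 * B x * (u 0 1 * v 0 1 + u 1 1 * v 1 1 + (u 0 2 * v 0 2 + u 1 2 * v 1 2))).
Proof.
have dk k := is_derive_cst (k : R) x u.
apply: (is_derive_eq (is_deriveD (is_deriveM (dk _) (is_derive_dA u x v))
  (is_deriveM (is_deriveM (dk _) (is_derive_B x u)) (is_derive_dB u x v)))).
rewrite !fctE /GRing.scale /= /cst; ring.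
Qed.

Let vacuum : M := real_coords 0 (ofreal (-1 + Num.sqrt w)) 0.

(** At the vacuum [Q] and [dA] vanish. What survives is [2 * b * dQ u * dQ v], where [dQ v] equals 4
    w^(3/2) times [v 0 1], together with the constant second derivative of the term -4 w^2 c
    |phi|^2. *)
Lemma is_D2_model u v : 0 <= w ->
  is_D2 model_potential (real_coords 0 (ofreal (-1 + Num.sqrt w)) 0) u v
  (b * (32 * w ^+ 3 * u 0 1 * v 0 1
        - 8 * w ^+ 2 * c * (u 0 0 * v 0 0 + u 1 0 * v 1 0))).
Proof.
move=> w0; split.
  apply: (@filterE _ (nbhs vacuum) (nbhs_filter vacuum)) => x.
  by case: (is_derive_model x v).
have dk k := is_derive_cst (k : R) vacuum u.
rewrite derive_model; apply: (is_derive_eq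
  (is_deriveM (dk _) (is_deriveB
    (is_deriveM (is_deriveM (dk _) (is_derive_Q vacuum u))
      (is_derive_dQ u vacuum v))
    (is_deriveM (dk _) (is_derive_dA u vacuum v))))).
rewrite /dQ /Q /dB /dA /B /A !fctE /GRing.scale /= /cst /coord_fun !mxE /=.
rewrite /rpart /ipart /=.
(* Writing [w] as [t ^+ 2] turns the claim into a polynomial identity in [t]. *)
move: (Num.sqrt w) (sqr_sqrtr w0) => t <-; ring.
Qed.

(** Each term of the gradient has a factor [Q] or [dA v], and both are zero at the vacuum. *)
Lemma critical_point_model : 0 <= w ->
  critical_point model_potential (real_coords 0 (ofreal (-1 + Num.sqrt w)) 0).
Proof.
move=> w0; split; first exact: differentiable_model.
move=> v; rewrite (@derive_val _ _ _ _ _ _ _ (is_derive_model vacuum v)).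
rewrite /model_gradient.
rewrite /dQ /Q /dB /dA /B /A !fctE /GRing.scale /= /cst /coord_fun !mxE /=.
rewrite /rpart /ipart /=.
move: (Num.sqrt w) (sqr_sqrtr w0) => t <-; ring.
Qed.

End Derivatives.

(** * The spectral action potential as an instance of the polynomial model *)

Section RealCoordinates.
Variables (R : realType) (f0 f2 Lam : R) (kx ky : Cplx R).
Hypotheses (hf0 : 0 < f0) (hf2 : 0 < f2) (hLam : 0 < Lam) (hky : ky != 0).

Lemma on_real_coords_potential :
  on_real_coords (potential f0 f2 Lam kx ky) =
  model_potential (f0 * cmod ky ^+ 4 / (4 * pi ^+ 2))
    (cmod kx ^+ 2 / cmod ky ^+ 2) (vacuum_w f0 f2 Lam ky).
Proof.
apply/funext => x; rewrite /on_real_coords potentialE // /rho !sqr_cmod.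
by rewrite /model_potential !fctE /cst /coord_fun /rpart /ipart /= add0r.
Qed.

End RealCoordinates.

(** * The unit circle and continuity of maps into and out of C *)

Section UnitCircle.
Variable R : realType.
Local Notation C := (Cplx R).

Definition cis (t : R) : C := Complex (cos t) (sin t).

Lemma cis0 : cis 0 = 1.
Proof. by rewrite /cis cos0 sin0. Qed.

Lemma cis_conj t : cis t * Num.conj (cis t) = 1.
Proof.
rewrite -normCK normc_def /= cos2Dsin2 sqrtr1.
by rewrite expr1n.
Qed.

Lemma complex_continuous (f g : R -> R) :
  continuous f -> continuous g ->
  continuous (fun t => Complex (f t) (g t) : C).
Proof.
move=> cf cg t; apply/cvgrPdist_lt => -[e1 e2] he.
(* The radius is itself an element of C, and positivity in its partial order forces it to be
   real. *)
have [e20 e10] : e2 = 0 /\ 0 < e1.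
  by move: he; rewrite ltcE /= => /andP[/eqP <- ->].
(* Half the radius suffices for each part: the squared modulus is then below e1^2 / 2. *)
have e20' : 0 < e1 / 2 by rewrite divr_gt0.
have /cvgrPdist_lt/(_ _ e20') hf := cf t.
have /cvgrPdist_lt/(_ _ e20') hg := cg t.
near=> u.
have hfu : `|f t - f u| < e1 / 2 by near: u.
have hgu : `|g t - g u| < e1 / 2 by near: u.
rewrite normc_def e20 ltcR /=.
rewrite -(ger0_norm (ltW e10)) -sqrtr_sqr ltr_sqrt ?exprn_gt0 //.
rewrite -(real_normK (num_real (f t - f u))).
rewrite -(real_normK (num_real (g t - g u))).
have sq (x : R) : `|x| < e1 / 2 -> `|x| ^+ 2 < (e1 / 2) ^+ 2.
  by move=> hx; rewrite ltr_pXn2r ?nnegrE // ltW.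
apply: lt_le_trans (ltrD (sq _ hfu) (sq _ hgu)) _; rewrite -subr_ge0.
have -> : e1 ^+ 2 - ((e1 / 2) ^+ 2 + (e1 / 2) ^+ 2) = e1 ^+ 2 / 2 by field.
by rewrite divr_ge0 ?sqr_ge0.
Unshelve. all: by end_near. Qed.

Lemma cis_continuous : continuous cis.
Proof.
by apply: complex_continuous; [exact: continuous_cos|exact: continuous_sin].
Qed.

(** The angle [acos x] has the right cosine and has sine |y|, so the sign of [y] decides between
    this angle and its opposite. *)
Lemma cis_surj (z : C) : z * Num.conj z = 1 -> exists t, z = cis t.
Proof.
case: z => x y /=; rewrite -normCK normc_def /= => h.
have {}h : x ^+ 2 + y ^+ 2 = 1.
  move: h; rewrite -rmorphXn /= sqr_sqrtr ?addr_ge0 ?sqr_ge0 //.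
  by case.
have x1 : -1 <= x <= 1.
  rewrite -ler_norml -(expr_le1 (ltn0Sn 1)) // real_normK ?num_real //.
  by rewrite -h lerDl sqr_ge0.
have hs : sin (acos x) = `|y|.
  by rewrite sin_acos // -h addrAC subrr add0r sqrtr_sqr.
have hc : cos (acos x) = x by rewrite acosK // in_itv.
have [y0|y0] := leP 0 y.
  by exists (acos x); rewrite /cis hc hs ger0_norm.
by exists (- acos x); rewrite /cis cosN sinN hc hs ltr0_norm // opprK.
Qed.

Lemma rpart_continuous : continuous (@rpart R).
Proof.
move=> z A /nbhs_ballP[e /= e0 eA]; apply/nbhs_ballP.
exists (ofreal e) => /=; first by rewrite ltcR.
move=> u zu; apply: eA; move: zu; rewrite /ball /=.
rewrite normc_def ltcR => /(le_lt_trans _); apply.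
rewrite -sqrtr_sqr ler_sqrt ?addr_ge0 ?sqr_ge0 //.
by rewrite /rpart raddfB lerDl sqr_ge0.
Qed.

Lemma conj_continuous : continuous (@Num.conj C).
Proof.
move=> z A /nbhs_ballP[e /= e0 eA]; apply/nbhs_ballP; exists e => // u zu.
by apply: eA; move: zu; rewrite /ball /= -rmorphB norm_conjC.
Qed.

End UnitCircle.

(** * Unitary groups, gauge invariance and equality of Dirac operators *)

Section Model.
Variable R : realType.
Local Notation C := (Cplx R).
Local Notation Aev := (C * C * 'M[C]_2)%type.
Implicit Types g : Aev.
Local Open Scope sesquilinear_scope.

Lemma ord2_eq (i : 'I_2) : i = 0 \/ i = 1.
Proof. by case: i => -[|[|//]] hi; [left|right]; exact/val_inj. Qed.

Lemma ord2P (P : 'I_2 -> Prop) : P 0 -> P 1 -> forall i, P i.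
Proof. by move=> P0 P1 i; case: (ord2_eq i) => ->. Qed.

Lemma matrix2P (A B : 'M[C]_2) :
  A 0 0 = B 0 0 -> A 0 1 = B 0 1 -> A 1 0 = B 1 0 -> A 1 1 = B 1 1 -> A = B.
Proof.
by move=> h00 h01 h10 h11; apply/matrixP; apply: ord2P; apply: ord2P.
Qed.

Lemma diag2E (a b : C) (i j : 'I_2) :
  diag2 a b i j = if i == j then (if i == 0 then a else b) else 0.
Proof.
move: i j; apply: ord2P; apply: ord2P; rewrite /diag2 mxE;
  case: (@splitP 1 1) => k /= hk;
  rewrite ?ord1 // in hk *; rewrite mxE; case: (@splitP 1 1) => l /= hl;
  by rewrite ?ord1 // in hl *; rewrite !mxE.
Qed.

Lemma scalar_vecE (s1 s2 : C) :
  (scalar_vec s1 s2 0 0 = 1 + s1) * (scalar_vec s1 s2 1 0 = s2).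
Proof.
split; rewrite /scalar_vec mxE; case: (@splitP 1 1) => k /= hk;
  by rewrite ?ord1 // in hk *; rewrite !mxE.
Qed.

Lemma sum_ord2 (F : 'I_2 -> C) : \sum_i F i = F 0 + F 1.
Proof. by rewrite big_ord_recl big_ord1; congr (_ + F _); exact/val_inj. Qed.

Lemma unitary_groupP g : unitary_group setT g <->
  [/\ g.1.1 * Num.conj g.1.1 = 1, g.1.2 * Num.conj g.1.2 = 1,
      g.2 *m g.2 ^t* = 1%:M & g.2 ^t* *m g.2 = 1%:M].
Proof.
case: g => [[a b] u]; split => /= [[_ h1 h2]|[h1 h2 h3 h4]].
  by case: h1 => ? ? ?; case: h2.
split => //; congr (_, _, _) => //; by rewrite mulrC.
Qed.

Lemma norm_unimodular (z : C) : z * Num.conj z = 1 -> `|z| = 1.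
Proof. by rewrite -normCK => /eqP; rewrite sqrp_eq1 // => /eqP. Qed.

Lemma conj_unimodular_neq0 g : unitary_group setT g -> Num.conj g.1.1 != 0.
Proof.
case/unitary_groupP => ha _ _ _; apply: contraTneq isT => a0.
by move: ha; rewrite a0 mulr0 => /esym/eqP; rewrite oner_eq0.
Qed.

Lemma rho_scalar_vec (s1 s2 : C) :
  (scalar_vec s1 s2) ^t* *m scalar_vec s1 s2 = (ofreal (rho s1 s2))%:M.
Proof.
have [v0 v1] := scalar_vecE s1 s2; move: (scalar_vec s1 s2) v0 v1 => v v0 v1.
apply/matrixP => i j; rewrite !ord1 !mxE sum_ord2 !mxE v0 v1 eqxx mulr1n.
rewrite ![Num.conj _ * _]mulrC -!normCK -!ofreal_cmod /rho.
have E x : ofreal x = real_complex R x by [].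
by rewrite !E rmorphD !rmorphXn.
Qed.

(** rho is the squared Hermitian norm of v by [rho_scalar_vec], and a gauge transformation
    multiplies v by the unitary matrix [Num.conj g.1.1 *: g.2]. *)
Lemma rho_gauge g (f : C * C * C) : unitary_group setT g ->
  rho (gauge_fields g f).1.2 (gauge_fields g f).2 = rho f.1.2 f.2.
Proof.
case: g f => [[a b] u] [[phi s1] s2] /unitary_groupP[/= ha _ _ hu].
have inj (x y : R) : (ofreal x)%:M = (ofreal y)%:M :> 'M[C]_1 -> x = y.
  by move=> /matrixP/(_ 0 0); rewrite !mxE eqxx !mulr1n => -[].
apply: inj; rewrite -!rho_scalar_vec scalar_vecK /=.
set v := scalar_vec s1 s2.
have adjZ (k : C) (y : 'cV[C]_2) : (k *: y) ^t* = Num.conj k *: y ^t*.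
  by apply/matrixP => i j; rewrite !mxE rmorphM.
rewrite adjZ conjCK adjM.
rewrite -scalemxAl -scalemxAr scalerA ha scale1r.
by rewrite -mulmxA (mulmxA _ u) hu mul1mx.
Qed.

(** The potential depends on the fields only through |phi| and rho, and phi is multiplied by a
    phase. *)
Lemma potential_gauge (f0 f2 Lam : R) (kx ky : C) g (f : C * C * C) :
  unitary_group setT g ->
  let f' := gauge_fields g f in
  potential f0 f2 Lam kx ky f'.1.1 f'.1.2 f'.2 =
  potential f0 f2 Lam kx ky f.1.1 f.1.2 f.2.
Proof.
move=> hg f'; rewrite /potential rho_gauge //.
suff -> : cmod f'.1.1 = cmod f.1.1 by [].
case/unitary_groupP : hg => h1 h2 _ _.
rewrite /cmod; congr rpart.
rewrite -[LHS]/(`|g.1.1 * Num.conj g.1.2 * f.1.1|) !normrM norm_conjC.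
by rewrite (norm_unimodular h1) (norm_unimodular h2) !mul1r.
Qed.

(** It sends e_1 to - e_1, so it changes the sign of the vacuum vector and represents the second
    coset of the unitary group of [AF] in the stabilizer of the vacuum operator. *)
Definition flip : Aev := (1, 1, diag2 (-1) 1).

Lemma flipK : flip * flip = 1.
Proof.
congr (_, _, _); rewrite ?mulr1 //.
apply: matrix2P; by rewrite mxE sum_ord2 !diag2E /= ?mxE /=; ring.
Qed.

Lemma starM g g' : star (g * g') = star g' * star g.
Proof.
rewrite /star /=; congr (_, _, _); try by rewrite rmorphM mulrC.
exact: adjM.
Qed.

Lemma star_flip : star flip = flip.
Proof. by rewrite /star /= !conjC1 tr_diag2 conj_diag2 rmorphN !rmorph1. Qed.

Lemma unitary_flip g : unitary_group setT (g * flip) <-> unitary_group setT g.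
Proof.
have H g' : unitary_group setT g' -> unitary_group setT (g' * flip).
  move=> [_ h1 h2]; split => //; rewrite starM star_flip.
    by rewrite mulrA -(mulrA g') flipK mulr1.
  by rewrite mulrA -(mulrA flip) h2 mulr1 flipK.
by split => [/H|/H//]; rewrite -mulrA flipK mulr1.
Qed.

(* Column orthogonality makes a unitary 2x2 matrix diagonal as soon as one
   off-diagonal entry vanishes. *)
Lemma unitary_AFP g : unitary_group (@AF R) g <->
  [/\ unitary_group setT g, g.2 1 0 = 0 & Num.conj g.1.1 * g.2 0 0 = 1].
Proof.
case: g => [[a b] u] /=; split.
  move=> [[lR [lL [mu [-> -> ->]]]] h1 h2].
  have hg : unitary_group setT (lR, lL, diag2 lR mu) by [].
  split => //; first by rewrite diag2E.
  by rewrite diag2E /= mulrC; have /unitary_groupP[] := hg.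
move=> [hg u10 q]; have [ha _ _ hu] := (unitary_groupP _).1 hg.
have u00 : u 0 0 = a.
  by rewrite -[RHS]mulr1 -q mulrA ha mul1r.
have a0 := conj_unimodular_neq0 hg.
have u01 : u 0 1 = 0.
  have /matrixP/(_ 0 1) := hu.
  rewrite !mxE sum_ord2 !mxE u10 conjC0 mul0r addr0.
  by rewrite u00 => /eqP; rewrite mulf_eq0 (negPf a0) => /eqP.
case: hg => _ h1 h2; split => //.
by exists a, b, (u 1 1); congr (_, _, _); apply: matrix2P; rewrite diag2E.
Qed.

(** Right multiplication by [flip] negates the first column of the matrix, so the 1 of [unitary_AFP]
    becomes -1. *)
Lemma unitary_AF_flipP g : unitary_group (@AF R) (g * flip) <->
  [/\ unitary_group setT g, g.2 1 0 = 0 & Num.conj g.1.1 * g.2 0 0 = -1].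
Proof.
have E (i : 'I_2) : (g * flip).2 i 0 = - g.2 i 0.
  by rewrite mxE sum_ord2 !diag2E /= mulr0 addr0 mulrN1.
rewrite (propext (unitary_AFP _)) (propext (unitary_flip _)) !E /= mulr1.
split => -[h1 /eqP h2 h3]; split => //.
- by apply/eqP; rewrite -oppr_eq0.
- by rewrite -h3 mulrN opprK.
- by apply/eqP; rewrite oppr_eq0.
- by rewrite mulrN h3 opprK.
Qed.

Lemma tens_diag2_inj (A B : 'M[C]_2) :
  diag2 1 0 *t A = diag2 1 0 *t B -> A = B.
Proof.
move=> /matrixP h; apply/matrixP => i j.
(* The corner block, where e_11 has entry 1, is the second tensor factor itself. *)
have := h (mxtens_index (0, i)) (mxtens_index (0, j)).
by rewrite !tensmxE !diag2E !eqxx !mul1r.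
Qed.

(** The three equations compare the entries of the symmetric matrices v v^t; they determine v only
    up to a sign, which is where the extra coset comes from. *)
Lemma T_block_eqP (ky s1 s2 t1 t2 : C) : ky != 0 ->
  T_block ky s1 s2 = T_block ky t1 t2 <->
  [/\ (1 + s1) ^+ 2 = (1 + t1) ^+ 2, (1 + s1) * s2 = (1 + t1) * t2
    & s2 ^+ 2 = t2 ^+ 2].
Proof.
move=> k0; rewrite /T_block.
have [v0 v1] := scalar_vecE s1 s2; move: (scalar_vec s1 s2) v0 v1 => v v0 v1.
have [w0 w1] := scalar_vecE t1 t2; move: (scalar_vec t1 t2) w0 w1 => w w0 w1.
have outer (x : 'cV[C]_2) i j : (x *m x^T) i j = x i 0 * x j 0.
  by rewrite !mxE big_ord1 !mxE.
split => [h|[h1 h2 h3]].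
  have {}h : v *m v^T = w *m w^T.
    by apply: (scalerI k0); exact: tens_diag2_inj h.
  rewrite -v0 -v1 -w0 -w1 !expr2.
  by split; rewrite -!outer h.
congr (_ *t (_ *: _)); apply: matrix2P;
  rewrite !outer ?v0 ?v1 ?w0 ?w1 -?expr2 //.
by rewrite mulrC h2 mulrC.
Qed.

Lemma fluctuated_dirac_T_block (kx ky phi s1 s2 t1 t2 : C) :
  fluctuated_dirac kx ky phi s1 s2 = fluctuated_dirac kx ky phi t1 t2 ->
  T_block ky s1 s2 = T_block ky t1 t2.
Proof.
have dlE r1 r2 : dlsubmx (fluctuated_dirac kx ky phi r1 r2) = T_block ky r1 r2.
  exact: block_mxKdl.
move=> h; exact: etrans (esym (dlE s1 s2)) (etrans (congr1 _ h) (dlE t1 t2)).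
Qed.

(** * Stabilizers of the vacuum and the identity component *)

Section Vacuum.
Variables (s : C) (s1 : 1 + s != 0).

Lemma gauge_fields_vacuum g :
  gauge_fields g (0, s, 0) =
  (0, Num.conj g.1.1 * g.2 0 0 * (1 + s) - 1,
   Num.conj g.1.1 * g.2 1 0 * (1 + s)).
Proof.
rewrite /gauge_fields /= mulr0.
have [v0 v1] := scalar_vecE s 0; move: (scalar_vec s 0) v0 v1 => v v0 v1.
by congr (_, _ - _, _); rewrite !mxE sum_ord2 v0 v1 mulr0 addr0 mulrA.
Qed.

Lemma field_stabilizer_vacuum :
  field_stabilizer (0, s, 0) = unitary_group (@AF R).
Proof.
apply/seteqP; split => g /=.
  move=> [hg]; rewrite gauge_fields_vacuum => -[h1 /eqP h2].
  apply/unitary_AFP; split => //.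
    move: h2; rewrite !mulf_eq0 (negPf s1).
    by rewrite (negPf (conj_unimodular_neq0 hg)) orbF => /eqP.
  by apply: (mulIf s1); rewrite mul1r -[LHS](subrK 1) h1 addrC.
case/unitary_AFP => hg u10 q; split => //.
by rewrite gauge_fields_vacuum u10 q mulr0 !mul0r mul1r addrC addKr.
Qed.

(** By [fluctuated_dirac_gauge] the transformed operator is the operator of the transformed fields.
    As phi = 0, only the T blocks have to be compared; there q enters through its square, and u_L
    stays free. *)
Lemma operator_stabilizerP (kx ky : C) g : ky != 0 ->
  operator_stabilizer (fluctuated_dirac kx ky 0 s 0) g <->
  [/\ unitary_group setT g, g.2 1 0 = 0 & (Num.conj g.1.1 * g.2 0 0) ^+ 2 = 1].
Proof.
move=> k0; set q := _ * _; set D := fluctuated_dirac _ _ _ _ _.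
have E : unitary_group setT g -> gauge_transform g D =
    fluctuated_dirac kx ky 0 (q * (1 + s) - 1)
      (Num.conj g.1.1 * g.2 1 0 * (1 + s)).
  move=> hg.
  by rewrite (fluctuated_dirac_gauge kx ky (0, s, 0) hg) gauge_fields_vacuum.
split => [[hg]|[hg u10 q1]].
  move=> h; have /fluctuated_dirac_T_block := etrans (esym (E hg)) h.
  move=> /(T_block_eqP _ _ _ _ k0)[h1 _ h3].
  split => //.
    move: h3; rewrite expr0n => /eqP; rewrite sqrf_eq0 !mulf_eq0 (negPf s1).
    by rewrite (negPf (conj_unimodular_neq0 hg)) orbF => /eqP.
  move: h1; rewrite addrC subrK exprMn => h1.
  by apply: (mulIf (expf_neq0 2 s1)); rewrite h1 mul1r.
split=> [//|]; apply: (etrans (E hg)); rewrite u10 mulr0 mul0r.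
suff TE : T_block ky (q * (1 + s) - 1) 0 = T_block ky s 0.
  by rewrite /D /fluctuated_dirac TE.
apply/(T_block_eqP _ _ _ _ k0); rewrite addrC subrK !mulr0 exprMn q1 mul1r.
by split.
Qed.

Lemma operator_stabilizer_vacuum (kx ky : C) : ky != 0 ->
  operator_stabilizer (fluctuated_dirac kx ky 0 s 0) =
  [set g | unitary_group (@AF R) g \/ unitary_group (@AF R) (g * flip)].
Proof.
move=> k0; apply/seteqP; split => g /=.
  case/(operator_stabilizerP _ _ k0) => hg u10 /eqP; rewrite sqrf_eq1.
  case/orP => /eqP q; [left; exact/unitary_AFP|right; exact/unitary_AF_flipP].
case=> [/unitary_AFP[hg u10 q]|/unitary_AF_flipP[hg u10 q]];
  by apply/(operator_stabilizerP _ _ k0); split => //; rewrite q ?sqrrN expr1n.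
Qed.

(** A one-parameter subgroup of U(1)^3: it starts at the identity and reaches the element with
    angles [a], [b], [m] at t = 1. *)
Definition torus_path (a b m t : R) : Aev :=
  (cis (t * a), cis (t * b), diag2 (cis (t * a)) (cis (t * m))).

Lemma matrix_continuous (T : topologicalType) (f : T -> 'M[C]_2) :
  (forall i j, continuous (fun t => f t i j)) -> continuous f.
Proof.
(* A neighbourhood of a matrix contains a product of neighbourhoods of its entries, which amounts to
   finitely many conditions. *)
move=> cf t A [B hB sB]; apply: (filterS (fun u => @sB (f u))).
apply: filter_forall => i; apply: filter_forall => j.
exact: (cf i j t _ (hB i j)).
Qed.

Lemma torus_path_continuous a b m : continuous (torus_path a b m).
Proof.
have cc x : continuous (fun t : R => cis (t * x)).
  move=> t; apply: continuous_comp; last exact: cis_continuous.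
  exact: mulrr_continuous.
have cd : continuous (fun t : R => diag2 (cis (t * a)) (cis (t * m))).
  apply: matrix_continuous => i j.
  rewrite (_ : (fun t : R => _) = (fun t : R => if i == j then
    (if i == 0 then cis (t * a) else cis (t * m)) else 0)); last first.
    by apply/funext => t; rewrite diag2E.
  case: (i == j); last by move=> ?; exact: cvg_cst.
  by case: (i == 0); exact: cc.
have pair_continuous (U V : topologicalType) (f : R -> U) (g : R -> V) :
    continuous f -> continuous g -> continuous (fun t => (f t, g t)).
  by move=> cf cg t; apply: cvg_pair; [exact: cf|exact: cg].
exact: (pair_continuous _ _ _ _ (pair_continuous _ _ _ _ (cc a) (cc b)) cd).
Qed.

Lemma torus_path_AF a b m t : unitary_group (@AF R) (torus_path a b m t).
Proof.
have cisJ x : Num.conj (cis x) * cis x = 1 by rewrite mulrC cis_conj.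
split; first by exists (cis (t * a)), (cis (t * b)), (cis (t * m)).
- congr (_, _, _); rewrite ?cis_conj //=.
  rewrite tr_diag2 conj_diag2 -[LHS]/(_ *m _) mul_diag2 !cis_conj.
  by apply: matrix2P; rewrite diag2E mxE.
- congr (_, _, _); rewrite ?cisJ //=.
  rewrite tr_diag2 conj_diag2 -[LHS]/(_ *m _) mul_diag2 !cisJ.
  by apply: matrix2P; rewrite diag2E mxE.
Qed.

Lemma torus_path0 a b m : torus_path a b m 0 = 1.
Proof.
rewrite /torus_path !mul0r cis0; congr (_, _, _).
by apply: matrix2P; rewrite diag2E mxE.
Qed.

Lemma unitary_AF1 : unitary_group (@AF R) 1.
Proof. by rewrite -(torus_path0 0 0 0); exact: torus_path_AF. Qed.

(** Every element lies on a path through the identity, which makes this group connected. *)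
Lemma unitary_AF_torus g : unitary_group (@AF R) g ->
  exists a b m, g = torus_path a b m 1.
Proof.
case: g => [[x y] u] [[lR [lL [mu [-> -> ->]]]] h1 h2].
have hg : unitary_group setT (lR, lL, diag2 lR mu) by [].
have [/= /cis_surj[a ->] /cis_surj[b ->] + _] := (unitary_groupP _).1 hg.
rewrite tr_diag2 conj_diag2 mul_diag2 => /matrixP/(_ 1 1).
rewrite diag2E mxE /= => /cis_surj[m ->].
by exists a, b, m; rewrite /torus_path !mul1r.
Qed.

Lemma connected_component_vacuum (kx ky : C) : ky != 0 ->
  connected_component (operator_stabilizer (fluctuated_dirac kx ky 0 s 0)) 1 =
  unitary_group (@AF R).
Proof.
move=> k0; set B := operator_stabilizer _.
have AFB : unitary_group (@AF R) `<=` B.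
  by move=> g hg; rewrite /B operator_stabilizer_vacuum //; left.
apply/seteqP; split => g.
  set K := connected_component B 1 => Kg.
  have KB : K `<=` B := @connected_component_sub _ B 1.
  have K1 : K 1 by apply/connected_component_refl/AFB/unitary_AF1.
  (* This continuous function equals 1 on one coset and -1 on the other. *)
  pose q (h : Aev) : R := rpart (Num.conj h.1.1 * h.2 0 0).
  have qB h : B h -> q h = 1 \/ q h = -1.
    rewrite /B operator_stabilizer_vacuum // /q.
    case=> [/unitary_AFP[_ _ ->]|/unitary_AF_flipP[_ _ ->]]; first by left.
    by right; rewrite /rpart raddfN.
  have cq : continuous q.
    have c1 : continuous (fun h : Aev => h.1.1).
      move=> h; apply: (continuous_comp (f := fst) (g := fst));
        exact: cvg_fst.
    have c2 : continuous (fun h : Aev => h.2 0 0).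
      move=> h.
      apply: (continuous_comp (f := snd) (g := fun M : 'M[C]_2 => M 0 0)).
        exact: cvg_snd.
      exact: coord_continuous.
    have c3 : continuous (fun h : Aev => Num.conj h.1.1 * h.2 0 0).
      move=> h; apply: cvgM; last exact: c2.
      exact: (continuous_comp (c1 h) (@conj_continuous R _)).
    by move=> h; exact: (continuous_comp (c3 h) (@rpart_continuous R _)).
  have /connected_intervalP itv : connected (q @` K).
    apply: connected_continuous_connected; first exact: component_connected.
    exact: continuous_subspaceT.
  have := KB _ Kg; rewrite {1}/B operator_stabilizer_vacuum //.
  case=> [//|/unitary_AF_flipP[_ _ qg]].
  have q0 : (q @` K) 0.
    apply: (itv (-1) 1).
    - by exists g => //; rewrite /q qg /rpart raddfN.
    - by exists 1 => //; rewrite /q /= conjC1 mul1r mxE.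
    - by rewrite lerN10 ler01.
  case: q0 => h /KB/qB[->|->] /eqP; by rewrite ?oppr_eq0 oner_eq0.
move=> /unitary_AF_torus[a [b [m ->]]].
(* The image of the path is a connected subset of the stabilizer containing both the identity and
   the given element. *)
apply: (@connected_component_max _ B (range (torus_path a b m))).
- by exists 0 => //; exact: torus_path0.
- by move=> _ [t _ <-]; exact/AFB/torus_path_AF.
- apply: connected_continuous_connected; last first.
    exact/continuous_subspaceT/torus_path_continuous.
  by apply/connected_intervalP => x y _ _ z _.
- by exists 1.
Qed.

End Vacuum.
End Model.

(** * Minimality, Hessian and criticality at the vacuum *)

Section VacuumEnergy.
Variables (R : realType) (f0 f2 Lam : R) (kx ky : Cplx R).
Hypotheses (hf0 : 0 < f0) (hf2 : 0 < f2) (hLam : 0 < Lam) (hky : ky != 0).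

Let w := vacuum_w f0 f2 Lam ky.
Let s := vacuum_s1 f0 f2 Lam ky.

Lemma one_plus_vacuum_s1 : 1 + s = ofreal (Num.sqrt w).
Proof.
have E x : ofreal x = real_complex R x by [].
by rewrite /s /vacuum_s1 !E rmorphD rmorphN rmorph1 addrA subrr add0r.
Qed.

Lemma one_plus_vacuum_s1_neq0 : 1 + s != 0.
Proof.
rewrite one_plus_vacuum_s1; apply/eqP => -[/eqP].
by rewrite sqrtr_eq0 leNgt vacuum_w_gt0.
Qed.

Lemma rho_vacuum : rho s 0 = w.
Proof.
rewrite /rho one_plus_vacuum_s1 cmod0 cmod_ofreal ger0_norm ?sqrtr_ge0 //.
by rewrite sqr_sqrtr ?expr0n ?addr0 // ltW // vacuum_w_gt0.
Qed.

(** On the slice phi = 0 the vacuum is even a global minimum: the potential there is b ((rho^2 -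
    w^2)^2 - w^4), and rho = w makes the square zero. *)
Lemma potential_vacuum_le (s1 s2 : Cplx R) :
  potential f0 f2 Lam kx ky 0 s 0 <= potential f0 f2 Lam kx ky 0 s1 s2.
Proof.
rewrite !potentialE // rho_vacuum cmod0 expr0n /= !mulr0 !add0r !subr0.
rewrite ler_pM2l; last first.
  by rewrite divr_gt0 ?mulr_gt0 ?exprn_gt0 ?cmod_gt0 ?pi_gt0.
by rewrite lerB // subrr expr0n sqr_ge0.
Qed.

(** The derivatives are along the real parts of the three fields. The factor |k_x|^2 / |k_y|^2 in
    the phi entry comes from the term -4 w^2 c |phi|^2 of the completed square; it is 1 exactly when
    |k_x| = |k_y|. *)
Lemma is_hessian_vacuum :
  is_hessian (@real_direction R) (on_real_coords (potential f0 f2 Lam kx ky))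
    (real_coords 0 s 0)
    ((f0 * cmod ky ^+ 4 / pi ^+ 2) *:
     diag_mx (\row_(j < 3)
       [:: - 2 * w ^+ 2 * (cmod kx ^+ 2 / cmod ky ^+ 2); 8 * w ^+ 3; 0]`_j)).
Proof.
move=> i j; rewrite (on_real_coords_potential kx hf0 hf2 hLam hky).
set H := fun_of_matrix _ i j.
suff -> : H = f0 * cmod ky ^+ 4 / (4 * pi ^+ 2) *
    (32 * w ^+ 3 * real_direction R i 0 1 * real_direction R j 0 1 -
     8 * w ^+ 2 * (cmod kx ^+ 2 / cmod ky ^+ 2) *
       (real_direction R i 0 0 * real_direction R j 0 0 +
        real_direction R i 1 0 * real_direction R j 1 0)).
  by apply: is_D2_model; rewrite ltW // vacuum_w_gt0.
have p0 : pi != 0 :> R by rewrite lt0r_neq0 // pi_gt0.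
rewrite /H /real_direction !mxE; move: (cmod kx ^+ 2 / _) => c.
move: w (cmod ky) (pi : R) p0 => v k p p0 {H}.
by case: i j => -[|[|[|//]]] hi [[|[|[|//]]] hj] /=; field.
Qed.

Lemma critical_point_vacuum :
  critical_point (on_real_coords (potential f0 f2 Lam kx ky))
    (real_coords 0 s 0).
Proof.
rewrite (on_real_coords_potential kx hf0 hf2 hLam hky).
apply: critical_point_model.
by rewrite ltW // vacuum_w_gt0.
Qed.

(** This covers the imaginary directions as well, so the signs in the theorem hold for all complex
    variations of the fields. *)
Lemma is_D2_vacuum (h0 h1 h2 : Cplx R) (h := real_coords h0 h1 h2) :
  is_D2 (on_real_coords (potential f0 f2 Lam kx ky)) (real_coords 0 s 0) h h
    (f0 * cmod ky ^+ 4 / (4 * pi ^+ 2) *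
     (32 * w ^+ 3 * rpart h1 ^+ 2
      - 8 * w ^+ 2 * (cmod kx ^+ 2 / cmod ky ^+ 2) * cmod h0 ^+ 2)).
Proof.
rewrite (on_real_coords_potential kx hf0 hf2 hLam hky).
have -> : 32 * w ^+ 3 * rpart h1 ^+ 2 = 32 * w ^+ 3 * h 0 1 * h 0 1.
  by rewrite !mxE /= expr2 !mulrA.
have -> : cmod h0 ^+ 2 = h 0 0 * h 0 0 + h 1 0 * h 1 0.
  by rewrite sqr_cmod !mxE /= !expr2.
by apply: is_D2_model; rewrite ltW // vacuum_w_gt0.
Qed.

End VacuumEnergy.

Theorem proposition9 (R : realType) (f0 f2 Lam : R) (kx ky : Cplx R)
  (hf0 : 0 < f0) (hf2 : 0 < f2) (hLam : 0 < Lam)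
  (hkx : kx != 0) (hky : ky != 0) :
  let V := potential f0 f2 Lam kx ky in
  let w := vacuum_w f0 f2 Lam ky in
  let s := vacuum_s1 f0 f2 Lam ky in
  let VR := on_real_coords V in
  let p := real_coords 0 s 0 in
  [/\ local_minimum (fun x : (Cplx R * Cplx R)%type => V 0 x.1 x.2) (s, 0),
      [/\ forall g, unitary_group setT g -> forall f : (Cplx R * Cplx R * Cplx R)%type,
            let f' := gauge_fields g f in
            V f'.1.1 f'.1.2 f'.2 = V f.1.1 f.1.2 f.2,
          field_stabilizer (0, s, 0) = unitary_group (@AF R),
          operator_stabilizer (fluctuated_dirac kx ky 0 s 0) =
            [set g | unitary_group (@AF R) g \/
                     unitary_group (@AF R) (g * (1, 1, diag2 (-1) 1))]
        & connected_component
            (operator_stabilizer (fluctuated_dirac kx ky 0 s 0)) 1 =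
            unitary_group (@AF R)],
      is_hessian (@real_direction R) VR p
        ((f0 * cmod ky ^+ 4 / pi ^+ 2) *:
         diag_mx (\row_(j < 3)
           [:: - 2 * w ^+ 2 * (cmod kx ^+ 2 / cmod ky ^+ 2); 8 * w ^+ 3; 0]`_j))
    & [/\ critical_point VR p,
          forall h : Cplx R, h != 0 ->
            exists2 l, is_D2 VR p (real_coords h 0 0) (real_coords h 0 0) l & l < 0
        & forall h1 h2 : Cplx R,
            exists2 l, is_D2 VR p (real_coords 0 h1 h2) (real_coords 0 h1 h2) l
                     & 0 <= l]].
Proof.
move=> V w s VR p.
have s1 := one_plus_vacuum_s1_neq0 hf0 hf2 hLam hky.
have w0 : 0 < w := vacuum_w_gt0 hf0 hf2 hLam hky.
have b0 : 0 < f0 * cmod ky ^+ 4 / (4 * pi ^+ 2).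
  by rewrite divr_gt0 ?mulr_gt0 ?exprn_gt0 ?cmod_gt0 ?pi_gt0.
have c0 : 0 < cmod kx ^+ 2 / cmod ky ^+ 2.
  by rewrite divr_gt0 ?exprn_gt0 ?cmod_gt0.
split.
- apply: (@filterE _ (nbhs (s, 0 : Cplx R))) => x.
  exact: potential_vacuum_le.
- split=> [g hg f| | |]; first exact: potential_gauge.
  - exact: field_stabilizer_vacuum.
  - exact: operator_stabilizer_vacuum.
  - exact: connected_component_vacuum.
- exact: is_hessian_vacuum.
split=> [|h h0|h1 h2]; first exact: critical_point_vacuum.
  eexists; first exact: is_D2_vacuum.
  rewrite expr0n mulr0 sub0r pmulr_rlt0 // oppr_lt0.
  apply: mulr_gt0; last by rewrite exprn_gt0 ?cmod_gt0.
  by apply: mulr_gt0 => //; rewrite mulr_gt0 ?exprn_gt0.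
(* For phi fixed the value is a nonnegative multiple of (Re h1)^2; it vanishes exactly in the
   directions tangent to the sphere rho = w. *)
eexists; first exact: is_D2_vacuum.
rewrite cmod0 expr0n mulr0 subr0; apply: mulr_ge0; first exact: ltW.
by apply: mulr_ge0; rewrite ?sqr_ge0 // mulr_ge0 // exprn_ge0 // ltW.
Qed.
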